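(* Work in max-plus algebra $\mathbb{R}_{\max,+}$ with $\mathbb{X}=\mathbb{R}\cup\{-\infty\}$, and let $n\geq1$. Let $\bm{B},\bm{D}\in\mathbb{X}^{n\times n}$ be matrices and $\bm{C}\in\mathbb{X}^{n\times n}$ a column-regular matrix such that the matrix $\bm{R}=\bm{B}\oplus\bm{D}\bm{C}$ satisfies $\mathrm{Tr}(\bm{R})\leq\mathbb{1}$. Let $\bm{g}\in\mathbb{X}^{n}$ be a vector and $\bm{f},\bm{h}\in\mathbb{X}^{n}$ regular vectors such that the row vector $\bm{s}^{-}=\bm{f}^{-}\bm{C}\oplus\bm{h}^{-}$ satisfies $\bm{s}^{-}\bm{R}^{\ast}\bm{g}\leq\mathbb{1}$. Consider the problem of minimizing $$\bm{x}^{-}\bm{1}\bm{1}^{T}\bm{x}$$ over vectors $\bm{x},\bm{y}\in\mathbb{X}^{n}$ with $\bm{x}$ regular, subject to $$\bm{B}\bm{x}\leq\bm{x},\quad \bm{C}\bm{x}=\bm{y},\quad \bm{D}\bm{y}\leq\bm{x},\quad \bm{g}\leq\bm{x}\leq\bm{h},\quad \bm{y}\leq\bm{f}.$$ Then the minimum value of the objective function in this problem is equal to $$\theta=\bigoplus_{0\leq i+j\leq n-2}\|\bm{s}^{-}\bm{R}^{i}\|\,\|\bm{R}^{j}\bm{g}\|\oplus\|\bm{R}^{\ast}\|,$$ and all regular solutions are given in the parametric form $$\bm{x}=\bm{G}\bm{u},\qquad \bm{y}=\bm{C}\bm{G}\bm{u},\qquad \bm{G}=\bigoplus_{0\leq i+j\leq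 n-2}\theta^{-1}\bm{R}^{i}\bm{1}\bm{1}^{T}\bm{R}^{j}\oplus\bm{R}^{\ast},$$ where $\bm{u}\in\mathbb{X}^{n}$, $\bm{u}\neq\bm{0}$, is a vector of parameters satisfying $$\bm{g}\leq\bm{u}\leq(\bm{s}^{-}\bm{G})^{-}.$$ That is, a pair $(\bm{x},\bm{y})$ with $\bm{x}$ regular is feasible and attains the minimum $\theta$ if and only if $\bm{x}=\bm{G}\bm{u}$ and $\bm{y}=\bm{C}\bm{G}\bm{u}$ for some such $\bm{u}$.
   Context: Max-plus algebra $\mathbb{R}_{\max,+}$: the set $\mathbb{X}=\mathbb{R}\cup\{-\infty\}$ with $\oplus=\max$, $\otimes=+$ (sign omitted), zero $\mathbb{0}=-\infty$, one $\mathbb{1}=0$, inverse $x^{-1}=-x$ for $x\neq\mathbb{0}$, and the usual linear order. Matrix and vector operations are the usual ones with $+,\times$ replaced by $\oplus,\otimes$; inequalities between vectors are entrywise. $\mathbb{X}^{n}$ denotes column vectors. $\bm{0}$ is the vector with all entries $\mathbb{0}$; a vector is regular if none of its entries is $\mathbb{0}$; a matrix is column-regular if no column consists entirely of $\mathbb{0}$. For a nonzero column vector $\bm{x}=(x_i)$, $\bm{x}^{-}$ is the row vector with entries $x_i^{-1}$ if $x_i\neq\mathbb{0}$ and $\mathbb{0}$ otherwise; for a nonzero row vector, $(\cdot)^{-}$ is defined in the same way and gives a column vector. $\bm{I}$ is the identity matrix ($\mathbb{1}$ on the diagonal, $\mathbb{0}$ elsewhere), $\bm{A}^{0}=\bm{I}$,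 $\bm{A}^{p}=\bm{A}^{p-1}\bm{A}$. For $\bm{A}=(a_{ij})\in\mathbb{X}^{n\times n}$: $\mathrm{tr}\,\bm{A}=\bigoplus_{k=1}^{n}a_{kk}$, $\mathrm{Tr}(\bm{A})=\bigoplus_{k=1}^{n}\mathrm{tr}\,\bm{A}^{k}$, and $\bm{A}^{\ast}=\bigoplus_{k=0}^{n-1}\bm{A}^{k}$ (Kleene star, used when $\mathrm{Tr}(\bm{A})\leq\mathbb{1}$). $\bm{1}=(\mathbb{1},\ldots,\mathbb{1})^{T}\in\mathbb{X}^{n}$. For a (row or column) vector or a matrix, $\|\cdot\|$ is the $\oplus$-sum (maximum) of all its entries: $\|\bm{x}\|=\bm{1}^{T}\bm{x}$ for a column vector, $\|\bm{z}\|=\bm{z}\bm{1}$ for a row vector, $\|\bm{A}\|=\bm{1}^{T}\bm{A}\bm{1}$. In sums over $0\leq i+j\leq n-2$, the indices $i,j$ are nonnegative integers; an empty sum is zero. Scheduling meaning: $x_i,y_i$ are the start and finish times of activity $i$, and the objective is the maximum absolute deviation of start times $\max_i x_i-\min_i x_i$ in ordinary notation. *)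

(* Defs.v *)
From HB Require Import structures.
From mathcomp Require Export all_boot all_order all_algebra.
From mathcomp Require Export reals.

Set Implicit Arguments.
Unset Strict Implicit.
Unset Printing Implicit Defensive.

Import Order.TTheory GRing.Theory Num.Theory.

Local Open Scope ring_scope.

(* [None] is -oo. The type is made a commutative semiring whose [0], [1], [+],
   [*] are -oo, the real 0, max and the real addition, so that the library's
   matrix operations, [\sum], [\tr] and [^+] over it are the max-plus ones. *)
Definition maxplus (K : realType) : Type := option K.

Section MaxPlus.
Variable K : realType.
Implicit Types x y z : maxplus K.

HB.instance Definition _ := Choice.copy (maxplus K) (option K).

Definition mpadd x y : maxplus K :=
  match x, y with
  | None, _ => y
  | _, None => x
  | Some a, Some b => Some (Num.max a b)
  end.

Definition mpmul x y : maxplus K :=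
  match x, y with
  | Some a, Some b => Some (a + b)
  | _, _ => None
  end.

Definition mple x y : bool :=
  match x, y with
  | None, _ => true
  | Some _, None => false
  | Some a, Some b => a <= b
  end.

Definition mplt x y : bool := (y != x) && mple x y.

Definition mpmin x y : maxplus K := if mplt x y then x else y.

Fact mpaddA : associative mpadd.
Proof. by move=> [a|] [b|] [c|] //=; rewrite maxA. Qed.

Fact mpaddC : commutative mpadd.
Proof. by move=> [a|] [b|] //=; rewrite maxC. Qed.

Fact mpadd0 : left_id (None : maxplus K) mpadd.
Proof. by []. Qed.

HB.instance Definition _ :=
  GRing.isNmodule.Build (maxplus K) mpaddA mpaddC mpadd0.

Fact mpmulA : associative mpmul.
Proof. by move=> [a|] [b|] [c|] //=; rewrite addrA. Qed.

Fact mpmulC : commutative mpmul.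
Proof. by move=> [a|] [b|] //=; rewrite addrC. Qed.

Fact mpmul1 : left_id (Some 0 : maxplus K) mpmul.
Proof. by move=> [a|] //=; rewrite add0r. Qed.

Fact mpmulDl : left_distributive mpmul mpadd.
Proof. by move=> [a|] [b|] [c|] //=; rewrite addr_maxl. Qed.

Fact mpmul0 : left_zero (None : maxplus K) mpmul.
Proof. by []. Qed.

Fact mp1_neq0 : (Some 0 : maxplus K) != 0.
Proof. by []. Qed.

HB.instance Definition _ :=
  GRing.Nmodule_isComNzSemiRing.Build (maxplus K)
    mpmulA mpmulC mpmul1 mpmulDl mpmul0 mp1_neq0.

Fact mpmin_def x y : mpmin x y = if mplt x y then x else y.
Proof. by []. Qed.

Fact mpmax_def x y : mpadd x y = if mplt x y then y else x.
Proof.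
case: x y => [a|] [b|] //=; rewrite /mplt //=.
by rewrite (inj_eq Some_inj) -lt_def maxEge; case: ltgtP => // ->.
Qed.

Fact mple_anti : antisymmetric mple.
Proof. by move=> [a|] [b|] //= /le_anti ->. Qed.

Fact mple_trans : transitive mple.
Proof. by move=> [b|] [a|] [c|] //=; apply: le_trans. Qed.

Fact mple_total : total mple.
Proof. by move=> [a|] [b|] //=; apply: le_total. Qed.

(* [ring_display] makes [<=] in [ring_scope] denote this order. *)
HB.instance Definition _ :=
  Order.isOrder.Build ring_display (maxplus K)
    (fun _ _ => erefl) mpmin_def mpmax_def mple_anti mple_trans mple_total.

Lemma mpaddE x y : x + y = Order.max x y.
Proof. exact: mpmax_def. Qed.

(* [mpinv 0 = 0], the value that conjugate vectors assign to zero entries. *)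
Definition mpinv x : maxplus K := omap (fun a => - a) x.

End MaxPlus.

Section MaxPlusMatrix.
Variable K : realType.
Local Notation X := (maxplus K).

Definition mxle m n (A B : 'M[X]_(m, n)) : Prop :=
  forall i j, A i j <= B i j.

Definition regular n (x : 'cV[X]_n) : Prop := forall i, x i 0 <> 0.

Definition column_regular m n (A : 'M[X]_(m, n)) : Prop :=
  forall j, exists i, A i j <> 0.

(* x |-> x^- on columns ([n = 1]) as well as on rows ([m = 1]). *)
Definition mpconj m n (A : 'M[X]_(m, n)) : 'M[X]_(n, m) :=
  map_mx (@mpinv K) A^T.

Definition mpnorm m n (A : 'M[X]_(m, n)) : X := \sum_i \sum_j A i j.

Definition ones n : 'cV[X]_n := const_mx 1.

Definition mpTr n (A : 'M[X]_n) : X := \sum_(1 <= k < n.+1) \tr (A ^+ k).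

Definition kstar n (A : 'M[X]_n) : 'M[X]_n := \sum_(0 <= k < n) A ^+ k.

Definition objective n (x : 'cV[X]_n) : X :=
  (mpconj x *m ones n *m (ones n)^T *m x) 0 0.

Definition feasible n (B C D : 'M[X]_n) (f g h x y : 'cV[X]_n) : Prop :=
  regular x /\
  [/\ mxle (B *m x) x, C *m x = y, mxle (D *m y) x,
      mxle g x /\ mxle x h & mxle y f].

(* The bound 0 <= i + j <= n - 2 is written i + j + 2 <= n, so that the sums
   are empty for n = 1 in spite of the truncated subtraction on nat. *)
Definition theta n (R : 'M[X]_n) (sm : 'rV[X]_n) (g : 'cV[X]_n) : X :=
  (\sum_(i < n) \sum_(j < n | (i + j + 2 <= n)%N)
     mpnorm (sm *m R ^+ i) * mpnorm (R ^+ j *m g))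
  + mpnorm (kstar R).

Definition genmx_sol n (R : 'M[X]_n) (t : X) : 'M[X]_n :=
  (\sum_(i < n) \sum_(j < n | (i + j + 2 <= n)%N)
     mpinv t *: (R ^+ i *m ones n *m (ones n)^T *m R ^+ j))
  + kstar R.

End MaxPlusMatrix.

(* Main.v *)
Require Import Defs.
From mathcomp Require Import zify.
Import Order.TTheory GRing.Theory Num.Theory.
Local Open Scope ring_scope.

(** On regular [x] the constraints amount to [R x <= x], [g <= x], [s^- x <= 1],
    and [objective x <= t] to [t^-1 1 1^T x <= x]. So [x] attains the value [t]
    iff [S x <= x] for [S = t^-1 1 1^T + R] (plus the other two constraints),
    that is [x = S^* u], provided [Tr S <= 1]. Since [|R^k| <= theta] for
    [k < n], products containing [theta^-1 1 1^T] twice are dominated by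
    products containing it once; hence [Tr S <= 1] and [S^* = G] at [t = theta].
    Conversely, [|x| |A| <= objective x * |A x|] for every [A]; applied to
    [s^- R^i] and to [R^*] it shows that no feasible [x] goes below [theta]. *)

Section Scalars.
Set Implicit Arguments.
Unset Strict Implicit.
Variable K : realType.
Implicit Types a b c d x y : maxplus K.

Lemma mp_ge0 a : (0 : maxplus K) <= a.
Proof. by case: a. Qed.

Lemma mp_le0 a : a <= (0 : maxplus K) -> a = 0.
Proof. by case: a. Qed.

Lemma mp_leD a b c : (a + b <= c) = (a <= c) && (b <= c).
Proof. by rewrite mpaddE ge_max. Qed.

Lemma mp_leDl a b : a <= a + b.
Proof. by rewrite mpaddE le_max lexx. Qed.

Lemma mp_leDr a b : b <= a + b.
Proof. by rewrite mpaddE le_max lexx orbT. Qed.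

Lemma mp_leM a b c d : a <= b -> c <= d -> a * c <= b * d.
Proof.
case: a b c d => [a|] [b|] [c|] [d|] //= ab cd.
exact: (lerD ab cd).
Qed.

Lemma mp_leMl a b c : b <= c -> a * b <= a * c.
Proof. exact: mp_leM. Qed.

Lemma mp_leMr a b c : b <= c -> b * a <= c * a.
Proof. by move=> bc; apply: mp_leM. Qed.

Lemma mp_sum_le (I : Type) (r : seq I) (P : pred I) (F : I -> maxplus K) c :
  (forall i, P i -> F i <= c) -> \sum_(i <- r | P i) F i <= c.
Proof.
move=> Fc; by elim/big_ind: _ => // a b ac bc; rewrite mp_leD ac bc.
Qed.

Lemma mp_le_sum (I : finType) (P : pred I) (F : I -> maxplus K) i :
  P i -> F i <= \sum_(j | P j) F j.
Proof. by move=> Pi; rewrite (bigD1 i) //= mp_leDl. Qed.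

Lemma mp_sum_attained (I : finType) (F : I -> maxplus K) :
  \sum_i F i <> 0 -> exists i, \sum_i F i = F i.
Proof.
elim/big_ind: _ => // [a b IHa IHb|i _ _]; last by exists i.
rewrite mpaddE; case: (leP a b) => _; [exact: IHb | exact: IHa].
Qed.

Lemma mp_mulf_neq0 a b : a <> 0 -> b <> 0 -> a * b <> 0.
Proof. by case: a b => [a|] [b|]. Qed.

Lemma mpinv_neq0 a : a <> 0 -> mpinv a <> 0.
Proof. by case: a. Qed.

Lemma mpinvM a : a <> 0 -> mpinv a * a = 1.
Proof. by case: a => // a _; congr Some; rewrite addNr. Qed.

Lemma mp_neq0_le a b : a <> 0 -> a <= b -> b <> 0.
Proof. by move=> a0 ab b0; apply: a0; apply: mp_le0; rewrite -b0. Qed.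

Lemma mp_leMinv a b c : a <> 0 -> (mpinv a * b <= c) = (b <= a * c).
Proof.
move=> a0; apply/idP/idP => H.
  by move: (mp_leMl a H); rewrite mulrA [a * _]mulrC mpinvM // mul1r.
by move: (mp_leMl (mpinv a) H); rewrite [X in _ <= X]mulrA mpinvM // mul1r.
Qed.

Lemma mp_leM2l a b c : a <> 0 -> (a * b <= a * c) = (b <= c).
Proof. by move=> a0; rewrite -mp_leMinv // mulrA mpinvM // mul1r. Qed.

Lemma mp_le_inv a b : a <> 0 -> (b <= mpinv a) = (a * b <= 1).
Proof. by move=> a0; rewrite -(mp_leM2l _ _ a0) [a * mpinv a]mulrC mpinvM. Qed.

End Scalars.

Section Matrices.
Set Implicit Arguments.
Unset Strict Implicit.
Variable K : realType.
Local Notation X := (maxplus K).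

Lemma mxle_refl m n (A : 'M[X]_(m, n)) : mxle A A.
Proof. by move=> i j. Qed.

Lemma mxle_trans m n (A B C : 'M[X]_(m, n)) : mxle A B -> mxle B C -> mxle A C.
Proof. by move=> leAB leBC i j; apply: le_trans (leBC i j). Qed.

Lemma mxle_anti m n (A B : 'M[X]_(m, n)) : mxle A B -> mxle B A -> A = B.
Proof. by move=> AB BA; apply/matrixP=> i j; apply: le_anti; rewrite AB BA. Qed.

Lemma mxleD m n (A B C : 'M[X]_(m, n)) : mxle (A + B) C <-> mxle A C /\ mxle B C.
Proof.
split=> [H|[leAC leBC] i j]; last by rewrite mxE mp_leD leAC leBC.
by split=> i j; have:= H i j; rewrite mxE mp_leD => /andP[].
Qed.

Lemma mxle_addl m n (A B : 'M[X]_(m, n)) : mxle A (A + B).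
Proof. by move=> i j; rewrite mxE mp_leDl. Qed.

Lemma mxle_addr m n (A B : 'M[X]_(m, n)) : mxle B (A + B).
Proof. by move=> i j; rewrite mxE mp_leDr. Qed.

Lemma mxleM m n p (A B : 'M[X]_(m, n)) (C D : 'M[X]_(n, p)) :
  mxle A B -> mxle C D -> mxle (A *m C) (B *m D).
Proof.
move=> AB CD i j; rewrite !mxE; apply: mp_sum_le => k _.
apply: le_trans (@mp_le_sum K _ xpredT (fun k => B i k * D k j) k isT).
exact: mp_leM.
Qed.

Lemma mxleZ m n (a b : X) (A B : 'M[X]_(m, n)) :
  a <= b -> mxle A B -> mxle (a *: A) (b *: B).
Proof. by move=> ab AB i j; rewrite !mxE; apply: mp_leM. Qed.

Lemma mxle_sum (I : Type) (r : seq I) (P : pred I) m n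
    (F : I -> 'M[X]_(m, n)) C :
  (forall i, P i -> mxle (F i) C) -> mxle (\sum_(i <- r | P i) F i) C.
Proof. by move=> FC i j; rewrite summxE; apply: mp_sum_le => k /FC. Qed.

Lemma mxle_le_sum (I : finType) (P : pred I) m n (F : I -> 'M[X]_(m, n)) i :
  P i -> mxle (F i) (\sum_(j | P j) F j).
Proof.
move=> Pi a b; rewrite summxE.
exact: (@mp_le_sum K _ P (fun j => F j a b) i).
Qed.

Lemma mxle_exp n (A B : 'M[X]_n) k : mxle A B -> mxle (A ^+ k) (B ^+ k).
Proof.
move=> AB; elim: k => [|k IH]; first exact: mxle_refl.
by rewrite !exprS; apply: mxleM.
Qed.

Lemma mulmx_outer m n (p : 'M[X]_(m, 1)) (q : 'M[X]_(1, n)) i j :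
  (p *m q) i j = p i 0 * q 0 j.
Proof. by rewrite mxE big_ord1. Qed.

Lemma mpnorm_le m n (A : 'M[X]_(m, n)) c :
  mpnorm A <= c <-> forall i j, A i j <= c.
Proof.
split=> [H i j|H]; last by do 2![apply: mp_sum_le => ? _].
apply: le_trans H.
apply: le_trans (@mp_le_sum K _ xpredT (fun i => \sum_j A i j) i isT).
exact: (@mp_le_sum K _ xpredT (fun j => A i j) j isT).
Qed.

Lemma mpnorm_entry m n (A : 'M[X]_(m, n)) i j : A i j <= mpnorm A.
Proof. by move: i j; apply/mpnorm_le. Qed.

Lemma mpnorm_mono m n (A B : 'M[X]_(m, n)) : mxle A B -> mpnorm A <= mpnorm B.
Proof.
move=> AB; apply/mpnorm_le => i j.
exact: le_trans (AB i j) (mpnorm_entry _ _ _).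
Qed.

Lemma mul_ones m n (A : 'M[X]_(m, n)) i : (A *m ones K n) i 0 = \sum_j A i j.
Proof. by rewrite mxE; apply: eq_bigr => j _; rewrite mxE mulr1. Qed.

Lemma mul_onesT m n (A : 'M[X]_(m, n)) j :
  ((ones K m)^T *m A) 0 j = \sum_i A i j.
Proof. by rewrite mxE; apply: eq_bigr => i _; rewrite !mxE mul1r. Qed.

Lemma mpnorm_row n (A : 'rV[X]_n) : mpnorm A = (A *m ones K n) 0 0.
Proof. by rewrite /mpnorm big_ord1 mul_ones. Qed.

Lemma mpnorm_col n (A : 'cV[X]_n) : mpnorm A = ((ones K n)^T *m A) 0 0.
Proof. by rewrite mul_onesT; apply: eq_bigr => i _; rewrite big_ord1. Qed.

Lemma mpnormE m n (A : 'M[X]_(m, n)) :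
  mpnorm A = ((ones K m)^T *m A *m ones K n) 0 0.
Proof.
rewrite -mulmxA mul_onesT; apply: eq_bigr => i _; by rewrite mul_ones.
Qed.

End Matrices.

Section KleeneStar.
Set Implicit Arguments.
Unset Strict Implicit.
Variables (K : realType) (n : nat).
Local Notation X := (maxplus K).
Implicit Types A : 'M[X]_n.

Lemma exp_mx_attained A k i j : (A ^+ k) i j <> 0 ->
  exists w : nat -> 'I_n,
    [/\ w 0 = i, w k = j & (A ^+ k) i j = \prod_(0 <= l < k) A (w l) (w l.+1)].
Proof.
elim: k j => [|k IH] j.
  rewrite expr0 mxE; case: eqP => // <- _.
  by exists (fun=> i); rewrite big_nil.
rewrite exprSr mxE => Hv; have [v Ev] := mp_sum_attained Hv.
rewrite Ev in Hv *.
have /IH [w [w0 wk Ew]] : (A ^+ k) i v <> 0 by move=> E; apply: Hv; rewrite E mul0r.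
exists (fun l => if (l <= k)%N then w l else j); split=> //; first by rewrite ltnn.
rewrite big_nat_recr //= leqnn ltnn wk Ew; congr (_ * _).
by apply: eq_big_nat => l /andP[_ lk]; rewrite ltnW // lk.
Qed.

Lemma walk_le_exp A (w : nat -> 'I_n) a b : (a <= b)%N ->
  \prod_(a <= l < b) A (w l) (w l.+1) <= (A ^+ (b - a)) (w a) (w b).
Proof.
elim: b => [|b IH].
  by rewrite leqn0 => /eqP->; rewrite big_geq // expr0 mxE eqxx.
rewrite leq_eqVlt => /predU1P[->|ab]; first by rewrite subnn big_geq // expr0 mxE eqxx.
rewrite big_nat_recr //= subSn // exprSr mxE.
apply: le_trans (@mp_le_sum K _ xpredT (fun v => (A ^+ (b - a)) (w a) v * A v (w b.+1)) (w b) isT).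
by apply: mp_leMr; apply: IH.
Qed.

Lemma exp_le_kstar A k : (k < n)%N -> mxle (A ^+ k) (kstar A).
Proof.
move=> kn; rewrite /kstar big_mkord.
exact: (@mxle_le_sum K _ xpredT _ _ (fun l : 'I_n => A ^+ l) (Ordinal kn) isT).
Qed.

Lemma kstar_le A (C : 'M[X]_n) :
  (forall k, (k < n)%N -> mxle (A ^+ k) C) -> mxle (kstar A) C.
Proof.
by move=> leAC; rewrite /kstar big_mkord; apply: mxle_sum => k _; apply: leAC.
Qed.

Lemma mpTr_le1 A : (forall k i, (0 < k <= n)%N -> (A ^+ k) i i <= 1) -> mpTr A <= 1.
Proof.
move=> H; rewrite /mpTr big_nat; apply: mp_sum_le => k.
by rewrite ltnS => /H {}H; apply: mp_sum_le => i _; apply: H.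
Qed.

Lemma mpTr_ge_diag A k i : (0 < k <= n)%N -> (A ^+ k) i i <= mpTr A.
Proof.
move=> /andP[k0 kn]; rewrite /mpTr.
rewrite (bigD1_seq k) /= ?iota_uniq // ?mem_index_iota ?k0 ?ltnS //.
apply: le_trans (mp_leDl _ _).
exact: (@mp_le_sum K _ xpredT (fun i => (A ^+ k) i i) i isT).
Qed.

(* A walk with at least [n] edges revisits a vertex within its first [n] steps;
   the closed part has weight at most [1] and can be cut out. *)
Lemma exp_le_kstar_of_Tr A : mpTr A <= 1 -> forall k, mxle (A ^+ k) (kstar A).
Proof.
move=> TrA k; elim/ltn_ind: k => k IH.
case: (ltnP k n) => [|nk i j]; first exact: exp_le_kstar.
have [->|/eqP Akij] := eqVneq ((A ^+ k) i j) 0; first exact: mp_ge0.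
have [w [w0 wk ->]] := exp_mx_attained Akij.
have [a [b [ab bn wab]]] : exists a b : nat, [/\ (a < b)%N, (b <= n)%N & w a = w b].
  have nI : ~ injective (fun a : 'I_n.+1 => w a).
    by move=> /leq_card; rewrite !card_ord ltnn.
  case: (boolP [exists a : 'I_n.+1, [exists b : 'I_n.+1, (a < b)%N && (w a == w b)]]).
    case/existsP=> a /existsP[b /andP[ab /eqP E]].
    by exists a, b; split=> //; rewrite -ltnS.
  move/existsPn => H; case: nI => a b E; apply: val_inj => /=.
  case: (ltngtP a b) => // ab.
    by move/existsPn/(_ b): (H a); rewrite ab E eqxx.
  by move/existsPn/(_ a): (H b); rewrite ab E eqxx.
have bk := leq_trans bn nk.
rewrite (big_cat_nat (n := b)) //= (big_cat_nat (n := a)) //=; last exact: ltnW.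
have cyc : \prod_(a <= l < b) A (w l) (w l.+1) <= 1.
  apply: le_trans (walk_le_exp _ _ (ltnW ab)) _.
  rewrite -wab; apply: le_trans TrA; apply: mpTr_ge_diag.
  by rewrite subn_gt0 ab (leq_trans (leq_subr _ _)).
apply: (@le_trans _ _ ((A ^+ a) i (w a) * (A ^+ (k - b)) (w a) j)).
  apply: mp_leM.
    rewrite -[leRHS]mulr1; apply: mp_leM cyc.
    by have := walk_le_exp A w (leq0n a); rewrite subn0 w0.
  by have := walk_le_exp A w bk; rewrite wk wab.
apply: (@le_trans _ _ ((A ^+ (a + (k - b))) i j)).
  rewrite exprD mxE.
  exact: (@mp_le_sum K _ xpredT (fun v => (A ^+ a) i v * (A ^+ (k - b)) v j) (w a) isT).
apply: IH; rewrite addnBA // ltn_subLR; last exact: leq_trans bk (leq_addl _ _).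
by rewrite ltn_add2r.
Qed.

Lemma mul_kstar_le A : mpTr A <= 1 -> mxle (A *m kstar A) (kstar A).
Proof.
move=> TrA; rewrite {1}/kstar mulmx_sumr; apply: mxle_sum => k _.
by have := exp_le_kstar_of_Tr TrA k.+1; rewrite exprS.
Qed.

End KleeneStar.

Section Residuation.
Set Implicit Arguments.
Unset Strict Implicit.
Variables (K : realType) (n : nat).
Local Notation X := (maxplus K).
Implicit Types (x f u v : 'cV[X]_n) (r : 'rV[X]_n).

Lemma mul_le1 r v : (r *m v) 0 0 <= 1 <-> forall i, r 0 i * v i 0 <= 1.
Proof.
rewrite mxE; split=> [H i|H]; last exact: mp_sum_le.
exact: le_trans (@mp_le_sum K _ xpredT (fun i => r 0 i * v i 0) i isT) H.
Qed.

Lemma mpconj_entry m p (A : 'M[X]_(m, p)) i j : mpconj A i j = mpinv (A j i).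
Proof. by rewrite !mxE. Qed.

Lemma le_regularP f v : regular f -> mxle v f <-> (mpconj f *m v) 0 0 <= 1.
Proof.
move=> f0; split=> [vf|/mul_le1 H i j].
  by apply/mul_le1 => i; rewrite mpconj_entry mp_leMinv // mulr1.
by move: (H i); rewrite !ord1 mpconj_entry mp_leMinv // mulr1.
Qed.

Lemma le_mpconjP r u : (forall i, r 0 i <> 0) ->
  mxle u (mpconj r) <-> (r *m u) 0 0 <= 1.
Proof.
move=> r0; split=> [H|/mul_le1 H i j].
  by apply/mul_le1 => i; move: (H i 0); rewrite !mxE mp_le_inv.
by rewrite !ord1 !mxE mp_le_inv.
Qed.

Lemma objectiveE x : objective x = mpnorm (mpconj x) * mpnorm x.
Proof. by rewrite /objective -mulmxA mulmx_outer mpnorm_row mpnorm_col. Qed.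

Lemma objective_le x t : regular x ->
  objective x <= t <-> forall i, mpnorm x <= t * x i 0.
Proof.
move=> x0; rewrite objectiveE; split=> [H i|H].
  rewrite mulrC -mp_leMinv //; apply: le_trans H; apply: mp_leMr.
  by rewrite -mpconj_entry mpnorm_entry.
rewrite /mpnorm big_ord1 mulr_suml; apply: mp_sum_le => i _.
by rewrite mpconj_entry mp_leMinv // mulrC; apply: H.
Qed.

Lemma mpnorm_mul_objective x m (A : 'M[X]_(m, n)) : regular x ->
  mpnorm x * mpnorm A <= objective x * mpnorm (A *m x).
Proof.
move=> x0; have /(objective_le _ x0) le_x := lexx (objective x).
rewrite [mpnorm A]/mpnorm mulr_sumr; apply: mp_sum_le => i _.
rewrite mulr_sumr; apply: mp_sum_le => j _.
apply: (@le_trans _ _ (objective x * (A i j * x j 0))).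
  by rewrite [leRHS]mulrCA [leLHS]mulrC; apply: mp_leMl.
apply: mp_leMl; apply: le_trans (mpnorm_entry _ i 0); rewrite [leRHS]mxE.
exact: (@mp_le_sum K _ xpredT (fun j => A i j * x j 0) j isT).
Qed.

Lemma exp_mul_le (A : 'M[X]_n) x k : mxle (A *m x) x -> mxle (A ^+ k *m x) x.
Proof.
move=> Ax; elim: k => [|k IH]; first by rewrite expr0 mul1mx; apply: mxle_refl.
rewrite exprSr -mulmxA; apply: mxle_trans IH.
by apply: mxleM => //; apply: mxle_refl.
Qed.

Lemma kstar_mul_le (A : 'M[X]_n) x : mxle (A *m x) x -> mxle (kstar A *m x) x.
Proof.
move=> Ax; rewrite /kstar mulmx_suml; apply: mxle_sum => k _.
exact: exp_mul_le.
Qed.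

Lemma le_kstar_mul (A : 'M[X]_n) x : (0 < n)%N -> mxle x (kstar A *m x).
Proof.
move=> n0; rewrite -[X in mxle X _]mul1mx -[1%:M]/(A ^+ 0).
by apply: mxleM; [apply: exp_le_kstar | apply: mxle_refl].
Qed.

End Residuation.

Section Jumps.
Set Implicit Arguments.
Unset Strict Implicit.
Variables (K : realType) (n : nat) (R : 'M[maxplus K]_n) (t : maxplus K).

Definition jump (i j : nat) : 'M[maxplus K]_n :=
  mpinv t *: (R ^+ i *m ones K n *m (ones K n)^T *m R ^+ j).

Definition jumps (k : nat) : 'M[maxplus K]_n :=
  \sum_(i < n) \sum_(j < n | (i + j + 2 <= k)%N) jump i j.

Definition jump_mx : 'M[maxplus K]_n := jump 0 0 + R.

Lemma genmx_solE : genmx_sol R t = jumps n + kstar R.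
Proof. by []. Qed.

Lemma jumps_le k (C : 'M[maxplus K]_n) :
  (forall i j, (i + j + 2 <= k)%N -> mxle (jump i j) C) -> mxle (jumps k) C.
Proof. by move=> H; apply: mxle_sum => i _; apply: mxle_sum => j; apply: H. Qed.

Lemma le_jumps k i j : (k <= n.+1)%N -> (i + j + 2 <= k)%N ->
  mxle (jump i j) (jumps k).
Proof.
move=> kn ijk.
have ltin : (i < n)%N by lia.
have ltjn : (j < n)%N by lia.
apply: mxle_trans
  (@mxle_le_sum K _ xpredT _ _
     (fun i : 'I_n => \sum_(j < n | (i + j + 2 <= k)%N) jump i j)
     (Ordinal ltin) isT).
exact: (@mxle_le_sum K _ (fun j : 'I_n => (i + j + 2 <= k)%N) _ _
          (fun j : 'I_n => jump i j) (Ordinal ltjn) ijk).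
Qed.

Lemma jumpE i j : jump i j = R ^+ i *m jump 0 0 *m R ^+ j.
Proof.
by rewrite /jump !expr0 mul1mx mulmx1 -scalemxAr -scalemxAl !mulmxA.
Qed.

Lemma jump_entry i j a b :
  jump i j a b = mpinv t * ((R ^+ i *m ones K n) a 0 * ((ones K n)^T *m R ^+ j) 0 b).
Proof. by rewrite mxE -mulmxA mulmx_outer. Qed.

Lemma jump00_mul (x : 'cV[maxplus K]_n) i :
  (jump 0 0 *m x) i 0 = mpinv t * mpnorm x.
Proof.
rewrite /jump !expr0 mul1mx mulmx1 -scalemxAl mxE -mulmxA mulmx_outer.
by rewrite mxE mul1r mpnorm_col.
Qed.

Hypotheses (t0 : t <> 0) (normR : forall k, (k < n)%N -> mpnorm (R ^+ k) <= t).

Lemma jump00_jump_le i j : (i < n)%N -> mxle (jump 0 0 *m jump i j) (jump 0 j).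
Proof.
move=> ltin.
have -> : jump 0 0 *m jump i j = (mpinv t * mpnorm (R ^+ i)) *: jump 0 j.
  apply/matrixP => a b; rewrite [LHS]mxE [RHS]mxE jump_entry.
  rewrite (eq_bigr (fun v => mpinv t * (mpinv t * ((ones K n)^T 0 v *
    (R ^+ i *m ones K n) v 0) * ((ones K n)^T *m R ^+ j) 0 b))); last first.
    move=> v _; rewrite !jump_entry !expr0 mul1mx mulmx1 [ones K n a 0]mxE mul1r.
    by rewrite -[LHS]mulrA; congr (_ * _); rewrite mulrCA !mulrA.
  rewrite -mulr_sumr -mulr_suml -mulr_sumr.
  have -> : \sum_v (ones K n)^T 0 v * (R ^+ i *m ones K n) v 0 = mpnorm (R ^+ i).
    by rewrite mpnormE -mulmxA [RHS]mxE.
  by rewrite expr0 mul1mx [ones K n a 0]mxE mul1r mulrCA !mulrA.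
rewrite -[X in mxle _ X]scale1r; apply: mxleZ; last exact: mxle_refl.
by rewrite mp_leMinv // mulr1 normR.
Qed.

Lemma jump_mx_exp_le k : (k <= n)%N ->
  mxle (jump_mx ^+ k) (jumps k.+1 + R ^+ k).
Proof.
elim: k => [_|k IH ltkn]; first by rewrite !expr0; apply: mxle_addr.
rewrite exprS.
apply: mxle_trans (mxleM (mxle_refl _) (IH (ltnW ltkn))) _.
have jle i j : (i + j + 2 <= k.+2)%N -> mxle (jump i j) (jumps k.+2 + R ^+ k.+1).
  move=> ijk; apply: mxle_trans (mxle_addl _ _).
  by apply: le_jumps => //; rewrite ltnS.
rewrite mulmxDr !mulmxDl; apply/mxleD; split; apply/mxleD; split.
- rewrite /jumps mulmx_sumr; apply: mxle_sum => i _.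
  rewrite mulmx_sumr; apply: mxle_sum => j ijk.
  by apply: mxle_trans (jump00_jump_le _ _) (jle _ _ _) => //; lia.
- rewrite /jumps mulmx_sumr; apply: mxle_sum => i _.
  rewrite mulmx_sumr; apply: mxle_sum => j ijk.
  have -> : R *m jump i j = jump i.+1 j.
    by rewrite jumpE [RHS]jumpE exprS !mulmxA.
  by apply: jle; lia.
- have -> : jump 0 0 *m R ^+ k = jump 0 k by rewrite [RHS]jumpE expr0 mul1mx.
  by apply: jle; lia.
- by rewrite exprS; apply: mxle_addr.
Qed.

Lemma jump_diag_le i j a : (i + j < n)%N -> jump i j a a <= 1.
Proof.
move=> ijn; rewrite jump_entry mp_leMinv // mulr1 mulrC.
apply: le_trans (normR ijn).
have -> : mpnorm (R ^+ (i + j)) =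
          ((ones K n)^T *m R ^+ j *m (R ^+ i *m ones K n)) 0 0.
  by rewrite mpnormE addnC exprD !mulmxA.
rewrite [leRHS]mxE.
exact: (@mp_le_sum K _ xpredT
  (fun a => ((ones K n)^T *m R ^+ j) 0 a * (R ^+ i *m ones K n) a 0) a isT).
Qed.

Lemma mpTr_jump_mx : mpTr R <= 1 -> mpTr jump_mx <= 1.
Proof.
move=> TrR; apply: mpTr_le1 => k a /andP[k0 kn].
apply: le_trans (jump_mx_exp_le kn a a) _.
rewrite mxE mp_leD; apply/andP; split; last first.
  by apply: le_trans TrR; apply: mpTr_ge_diag; rewrite k0.
rewrite summxE; apply: mp_sum_le => i _.
rewrite summxE; apply: mp_sum_le => j ijk.
by apply: jump_diag_le; lia.
Qed.

Lemma kstar_jump_mx : kstar jump_mx = genmx_sol R t.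
Proof.
rewrite genmx_solE; apply: mxle_anti.
  apply: kstar_le => k ltkn; apply: mxle_trans (jump_mx_exp_le (ltnW ltkn)) _.
  apply/mxleD; split; last first.
    by apply: mxle_trans (mxle_addr _ _); apply: exp_le_kstar.
  apply: mxle_trans (mxle_addl _ _); apply: jumps_le => i j ijk.
  by apply: le_jumps => //; apply: leq_trans ijk _.
have leR k : mxle (R ^+ k) (jump_mx ^+ k) by apply/mxle_exp/mxle_addr.
apply/mxleD; split; last first.
  by apply: kstar_le => k ltkn; apply: mxle_trans (exp_le_kstar _ ltkn).
apply: jumps_le => i j ijn; rewrite jumpE.
have ltn : (i + 1 + j < n)%N by lia.
apply: mxle_trans (exp_le_kstar _ ltn); rewrite !exprD.
by apply: mxleM => //; apply: mxleM => //; rewrite expr1; apply: mxle_addl.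
Qed.

End Jumps.

Section Optimum.
Set Implicit Arguments.
Unset Strict Implicit.
Variables (K : realType) (n : nat).
Local Notation X := (maxplus K).
Implicit Types (B C D R : 'M[X]_n) (f g h x y : 'cV[X]_n) (sm : 'rV[X]_n).

Lemma feasibleP B C D f g h x y : regular f -> regular h ->
  feasible B C D f g h x y <->
  regular x /\ [/\ mxle ((B + D *m C) *m x) x, C *m x = y, mxle g x
                 & ((mpconj f *m C + mpconj h) *m x) 0 0 <= 1].
Proof.
move=> f0 h0; rewrite /feasible !mulmxDl -!mulmxA.
rewrite [fun_of_matrix (_ + _) _ _]mxE mp_leD; split.
  move=> [x0 [Bx <- Dy [gx xh] yf]]; split=> //; split=> //.
    by apply/mxleD.
  by apply/andP; split; apply/le_regularP.
move=> [x0 [/mxleD[Bx Dx] <- gx /andP[yf xh]]]; split=> //; split=> //.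
  by split=> //; apply/le_regularP.
exact/le_regularP.
Qed.

Lemma le_theta R sm g i j : (i + j + 2 <= n)%N ->
  mpnorm (sm *m R ^+ i) * mpnorm (R ^+ j *m g) <= theta R sm g.
Proof.
move=> ijn.
have ltin : (i < n)%N by lia.
have ltjn : (j < n)%N by lia.
apply: le_trans (mp_leDl _ _).
apply: le_trans
  (@mp_le_sum K _ xpredT
     (fun i : 'I_n => \sum_(j < n | (i + j + 2 <= n)%N)
        mpnorm (sm *m R ^+ i) * mpnorm (R ^+ j *m g)) (Ordinal ltin) isT).
exact: (@mp_le_sum K _ (fun j : 'I_n => (i + j + 2 <= n)%N)
  (fun j : 'I_n => mpnorm (sm *m R ^+ i) * mpnorm (R ^+ j *m g))
  (Ordinal ltjn) ijn).
Qed.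

Lemma mpnorm_exp_le_theta R sm g k : (k < n)%N -> mpnorm (R ^+ k) <= theta R sm g.
Proof.
move=> ltkn; apply: le_trans (mp_leDr _ _).
by apply: mpnorm_mono; apply: exp_le_kstar.
Qed.

Lemma theta_neq0 R sm g : (0 < n)%N -> theta R sm g <> 0.
Proof.
move=> n0; apply: mp_neq0_le (mpnorm_exp_le_theta R sm g n0).
apply: mp_neq0_le (mpnorm_entry _ (Ordinal n0) (Ordinal n0)).
by rewrite expr0 mxE eqxx.
Qed.

Lemma theta_le_objective R sm g x : (0 < n)%N -> regular x ->
    mxle (R *m x) x -> mxle g x -> (sm *m x) 0 0 <= 1 ->
  theta R sm g <= objective x.
Proof.
move=> n0 x0 Rx gx smx.
have N0 : mpnorm x <> 0.
  exact: mp_neq0_le (x0 (Ordinal n0)) (mpnorm_entry _ _ _).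
rewrite mp_leD; apply/andP; split; last first.
  rewrite -(mp_leM2l _ _ N0); apply: le_trans (mpnorm_mul_objective _ x0) _.
  by rewrite mulrC; apply: mp_leMr; apply/mpnorm_mono/kstar_mul_le.
apply: mp_sum_le => i _; apply: mp_sum_le => j _.
apply: (@le_trans _ _ (mpnorm (sm *m R ^+ i) * mpnorm x)).
  apply: mp_leMl; apply: mpnorm_mono; apply: mxle_trans (exp_mul_le j Rx).
  by apply: mxleM gx; apply: mxle_refl.
rewrite mulrC; apply: le_trans (mpnorm_mul_objective _ x0) _.
rewrite -[leRHS]mulr1; apply: mp_leMl; apply/mpnorm_le => a b; rewrite !ord1.
apply: le_trans smx; rewrite -mulmxA; apply: mxleM; first exact: mxle_refl.
exact: exp_mul_le.
Qed.

Lemma mul_genmx_sol_le1 R sm g : (0 < n)%N -> (sm *m kstar R *m g) 0 0 <= 1 ->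
  (sm *m genmx_sol R (theta R sm g) *m g) 0 0 <= 1.
Proof.
move=> n0 smg; rewrite genmx_solE mulmxDr mulmxDl mxE mp_leD smg andbT.
set t := theta R sm g.
suff /(_ 0 0) : mxle (sm *m jumps R t n *m g) (const_mx 1) by rewrite [leRHS]mxE.
rewrite /jumps mulmx_sumr mulmx_suml; apply: mxle_sum => i _.
rewrite mulmx_sumr mulmx_suml; apply: mxle_sum => j ijn a b.
rewrite !ord1 [leRHS]mxE /jump -scalemxAr -scalemxAl mxE.
rewrite mp_leMinv; last exact: theta_neq0.
rewrite mulr1 !mulmxA -[_ *m _ *m g]mulmxA -[_ *m _^T *m _]mulmxA mulmx_outer.
by rewrite -mpnorm_row -mpnorm_col; apply: le_theta.
Qed.

Lemma objective_le_jump R t x : t <> 0 -> regular x ->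
  objective x <= t <-> mxle (jump R t 0 0 *m x) x.
Proof.
move=> t0 x0; split=> [/(objective_le _ x0) H i j|H].
  by rewrite !ord1 jump00_mul mp_leMinv.
apply/(objective_le _ x0) => i.
by move: (H i 0); rewrite jump00_mul mp_leMinv.
Qed.

(* For [n = 1] the sum in [genmx_sol] is empty, and regularity of [G u] comes
   from the star alone. *)
Lemma genmx_sol_mul_regular R t u : (0 < n)%N -> t <> 0 -> u <> 0 ->
  regular (genmx_sol R t *m u).
Proof.
move=> n0 t0 u0.
have [j uj] : exists j, u j 0 <> 0.
  have [/existsP[j /eqP]|/existsPn H] := boolP [exists j, u j 0 != 0].
    by exists j.
  case: u0; apply/matrixP => i j; rewrite ord1 mxE.
  by apply/eqP; rewrite -[_ == _]negbK H.
move=> i; suff Gij : genmx_sol R t i j <> 0.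
  rewrite mxE; apply: (mp_neq0_le (mp_mulf_neq0 Gij uj)).
  exact: (@mp_le_sum K _ xpredT (fun j => genmx_sol R t i j * u j 0) j isT).
rewrite genmx_solE; have [-> | ij] := eqVneq i j.
  apply: mp_neq0_le (mxle_addr _ _ _ _).
  apply: mp_neq0_le (exp_le_kstar R n0 j j).
  by rewrite expr0 mxE eqxx.
apply: mp_neq0_le (mxle_addl _ _ _ _).
have n2 : (2 <= n)%N.
  case: (n) i j ij {u0 uj u} n0 => [|[|]] // i j; by rewrite !ord1.
apply: mp_neq0_le (le_jumps R t (leqnSn n) (i := 0) (j := 0) n2 i j).
rewrite jump_entry !expr0 mul1mx mulmx1 !mxE.
by apply: mp_mulf_neq0; first exact: mpinv_neq0.
Qed.

End Optimum.

Theorem theorem5 (K : realType) (n : nat) (hn : (1 <= n)%N)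
    (B C D : 'M[maxplus K]_n) (f g h : 'cV[maxplus K]_n)
    (hC : column_regular C) (hf : regular f) (hh : regular h) :
  let R := B + D *m C in
  let sm := mpconj f *m C + mpconj h in
  mpTr R <= 1 ->
  (sm *m kstar R *m g) 0 0 <= 1 ->
  let t := theta R sm g in
  let G := genmx_sol R t in
  [/\ exists x y, feasible B C D f g h x y /\ objective x = t,
      forall x y, feasible B C D f g h x y -> t <= objective x
    & forall x y : 'cV[maxplus K]_n,
        feasible B C D f g h x y /\ objective x = t <->
        exists u : 'cV[maxplus K]_n,
          [/\ u <> 0, mxle g u, mxle u (mpconj (sm *m G)),
              x = G *m u & y = C *m G *m u]].
Proof.
move=> R sm TrR smg t G.
have t0 : t <> 0 by exact: theta_neq0.
have normR k : (k < n)%N -> mpnorm (R ^+ k) <= t by exact: mpnorm_exp_le_theta.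
have GE : kstar (jump_mx R t) = G := kstar_jump_mx t0 normR.
have SG : mxle (jump_mx R t *m G) G.
  by rewrite -GE; apply: mul_kstar_le; apply: mpTr_jump_mx.
have sm0 i : (sm *m G) 0 i <> 0.
  apply: (@mp_neq0_le K (sm 0 i)).
    apply: mp_neq0_le (mxle_addr _ _ _ _).
    by rewrite mpconj_entry; apply: mpinv_neq0; apply: hh.
  rewrite -[sm in X in X <= _]mulmx1; apply: mxleM; first exact: mxle_refl.
  by rewrite -GE -[1%:M]/(jump_mx R t ^+ 0); apply: exp_le_kstar.
have lower x y : feasible B C D f g h x y -> t <= objective x.
  case/(feasibleP _ _ _ _ _ _ hf hh) => x0 [Rx _ gx smx].
  exact: theta_le_objective.
have sound u : u <> 0 -> mxle g u -> mxle u (mpconj (sm *m G)) ->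
    feasible B C D f g h (G *m u) (C *m G *m u) /\ objective (G *m u) = t.
  move=> u0 gu /(le_mpconjP _ sm0) smu.
  have x0 : regular (G *m u) by exact: genmx_sol_mul_regular.
  have : mxle (jump_mx R t *m (G *m u)) (G *m u).
    by rewrite mulmxA; apply: mxleM SG (mxle_refl _).
  rewrite mulmxDl => /mxleD[Jx Rx].
  have fx : feasible B C D f g h (G *m u) (C *m G *m u).
    apply/feasibleP => //; split=> //; split=> //; last by rewrite mulmxA.
      by rewrite mulmxA.
    by apply: mxle_trans gu _; rewrite -GE; apply: le_kstar_mul.
  split=> //; apply: le_anti; rewrite (lower _ _ fx) andbT.
  exact/(objective_le_jump R t0 x0).
split=> //.
  pose u := mpconj (sm *m G).
  exists (G *m u), (C *m G *m u); apply: sound; last exact: mxle_refl.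
    move=> /matrixP /(_ (Ordinal hn) 0); rewrite mpconj_entry [RHS]mxE.
    exact: mpinv_neq0.
  by apply/le_mpconjP => //; apply: mul_genmx_sol_le1.
move=> x y; split=> [[fx ox] | [u [u0 gu uG -> ->]]]; last exact: sound.
case/(feasibleP _ _ _ _ _ _ hf hh): (fx) => x0 [Rx <- gx smx].
have xG : x = G *m x.
  rewrite -GE; apply: mxle_anti; first exact: le_kstar_mul.
  apply: kstar_mul_le; rewrite mulmxDl; apply/mxleD; split=> //.
  by apply/objective_le_jump => //; rewrite ox.
exists x; split=> //; last by rewrite -mulmxA -xG.
  by move=> xz; apply: (x0 (Ordinal hn)); rewrite xz mxE.
by apply/le_mpconjP => //; rewrite -mulmxA -xG.
Qed.
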